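(* Let $G(V,E)$ be a graph on $n$ vertices and let $G^{(1)},\ldots,G^{(k)}$ be a random $k$-partition of $G$. For any $\varepsilon\in(0,1)$, set $\lambda:=\Theta\big((\varepsilon/\log n)^2\big)$ and $\beta:=\Theta(\varepsilon^{-6}\log^7 n)$ (for suitable absolute constants in the $\Theta$-notation). Consider the coreset which, on input $G^{(i)}$, outputs an arbitrary $C^{(i)}=\mathrm{EDCS}(G^{(i)},\beta,(1-\lambda)\beta)$ together with the vertex set $F^{(i)}$ of vertices whose degree in $C^{(i)}$ is larger than $(1-\Theta(\varepsilon))\cdot\beta/2$ (for a suitable absolute constant in the $\Theta$). Then this is a $(2+\varepsilon)$-approximation randomized composable coreset of size $O(n\cdot\beta)$ for the minimum vertex cover problem: with high probability over the random partition, the set $F^{(1)}\cup\cdots\cup F^{(k)}$ together with a minimum vertex cover of the graph $C^{(1)}\cup\cdots\cup C^{(k)}$ is a vertex cover of $G$ of size at most $(2+\varepsilon)$ times the size of a minimum vertex cover of $G$.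
   Context: $\deg_H(v)$ is the degree of $v$ in subgraph $H$. A random $k$-partition of $G(V,E)$ is obtained by sending each edge independently to one of $k$ edge sets $E^{(1)},\ldots,E^{(k)}$ chosen uniformly at random, with $G^{(i)}=(V,E^{(i)})$. For $\beta>\beta^-$, an $\mathrm{EDCS}(G,\beta,\beta^-)$ is a subgraph $H$ of $G$ such that (P1) every edge $(u,v)\in H$ has $\deg_H(u)+\deg_H(v)\le\beta$ and (P2) every edge $(u,v)\in G\setminus H$ has $\deg_H(u)+\deg_H(v)\ge\beta^-$. For vertex cover, a randomized composable coreset is allowed to output, on each piece, both a set of edges and a set of vertices to be added directly to the final solution; the final solution is the union of all output vertex sets plus a vertex cover of the union of all output edge sets, and the size of the coreset is the number of edges (and vertices) output. ''With high probability'' means with probability $1-1/\mathrm{poly}(n)$. *)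

(* Defs.v *)
From HB Require Import structures.
From mathcomp Require Import all_boot all_order all_algebra.
From mathcomp Require Import boolp reals exp.
Set Implicit Arguments.
Unset Strict Implicit.
Unset Printing Implicit Defensive.
Import Order.TTheory GRing.Theory Num.Theory.
Local Open Scope ring_scope.

(* A graph (or subgraph) on the vertex set [T] is given by its set of edges;
   an edge is an unordered pair of distinct vertices. *)
Definition simple_graph (T : finType) (E : {set {set T}}) : Prop :=
  forall e, e \in E -> #|e| = 2.

Definition deg (T : finType) (H : {set {set T}}) (v : T) : nat :=
  #|[set e in H | v \in e]|.

Definition vertex_cover (T : finType) (E : {set {set T}}) (S : {set T}) : Prop :=
  forall e, e \in E -> exists2 v, v \in e & v \in S.

Definition min_vertex_cover (T : finType) (E : {set {set T}}) (S : {set T}) : Prop :=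
  vertex_cover E S /\ forall S', vertex_cover E S' -> (#|S| <= #|S'|)%N.

Definition EDCS (R : realType) (T : finType) (G : {set {set T}})
    (beta beta_minus : R) (H : {set {set T}}) : Prop :=
  [/\ H \subset G,
      forall u v, [set u; v] \in H -> (deg H u + deg H v)%:R <= beta
    & forall u v, [set u; v] \in G :\: H -> beta_minus <= (deg H u + deg H v)%:R].

Definition edge (T : finType) (E : {set {set T}}) : finType := {e | e \in E}.

Definition partition_of (T : finType) (E : {set {set T}}) (k : nat) : finType :=
  {ffun edge E -> 'I_k}.

Definition piece (T : finType) (E : {set {set T}}) (k : nat)
    (f : partition_of E k) (i : 'I_k) : {set {set T}} :=
  [set val x | x in [set x : edge E | f x == i]].

(* Product measure: each edge independently takes each value of ['I_k] with
   probability 1/k. *)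
Definition Pr_partition (R : realType) (T : finType) (E : {set {set T}}) (k : nat)
    (A : partition_of E k -> Prop) : R :=
  \sum_(f : partition_of E k | `[< A f >]) \prod_(x : edge E) k%:R^-1.
Arguments Pr_partition R {T E k} A.

(* The admissible outputs (edge set, vertex set) on each input piece; a relation
   rather than a function, since an output may be an arbitrary object of some
   kind. *)
Definition vc_coreset (T : finType) : Type :=
  {set {set T}} -> {set {set T}} -> {set T} -> Prop.

(* On the random [k]-partition of [E], [out] is an [alpha]-approximation coreset
   of size [s] for minimum vertex cover, with failure probability at most
   [delta]. The outputs are quantified inside the event, so that they may be
   chosen adversarially after the whole partition is known; the first clause
   says that an output always exists. *)
Definition randomized_composable_vc_coreset (R : realType) (T : finType)
    (E : {set {set T}}) (k : nat) (out : vc_coreset T) (alpha s delta : R) : Prop :=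
  [/\ forall G, simple_graph G -> exists C F, out G C F,
      forall G C F, simple_graph G -> out G C F -> (#|C| + #|F|)%:R <= s
    & 1 - delta <= Pr_partition R (fun f : partition_of E k =>
        forall (C : 'I_k -> {set {set T}}) (F : 'I_k -> {set T}) (M : {set T}),
          (forall i, out (piece f i) (C i) (F i)) ->
          min_vertex_cover (\bigcup_i C i) M ->
          vertex_cover E ((\bigcup_i F i) :|: M) /\
          forall S, min_vertex_cover E S ->
            #|(\bigcup_i F i) :|: M|%:R <= alpha * #|S|%:R)].

Definition edcs_vc_coreset (R : realType) (T : finType)
    (beta beta_minus threshold : R) : vc_coreset T :=
  fun G C F => EDCS G beta beta_minus C /\ F = [set v | threshold < (deg C v)%:R].

(* Main.v *)
Require Import Defs.
From mathcomp Require Import all_boot all_order all_algebra.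
From mathcomp Require Import boolp reals sequences exp.
From mathcomp Require Import zify ring lra.
Import Order.TTheory GRing.Theory Num.Theory.
Set Implicit Arguments.
Unset Strict Implicit.
Unset Printing Implicit Defensive.
Local Open Scope ring_scope.

(** Fix an EDCS [H] of the whole graph, with degrees [k] times larger. By a
    Chernoff bound the degrees of [H] in every piece are close to [deg H / k],
    so that the trace of [H] on a piece is almost an EDCS of it. Two near-EDCSs
    of the same graph have close degrees: a vertex where their degrees differ a
    lot forces many edges to vertices where they differ almost as much in the
    opposite direction, and the set of such vertices would grow geometrically.
    Hence all the [C i] have about the same degrees, and every vertex of some
    [F j] has degree at least about [beta / 2] in [C i0], for one fixed [i0].
    Counting the edges of [C i0] between [\bigcup_j F j :\: M] and [M] bounds
    the size. An edge outside the [C i] has by (P2) an endpoint of high degree,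
    which lies in some [F i]. *)

(** * Degrees and double counting in simple graphs *)

Section Graph.
Variable T : finType.
Implicit Types (A B G H X : {set {set T}}) (P N S : {set T}).

Lemma simple_graphS A G : A \subset G -> simple_graph G -> simple_graph A.
Proof. by move=> /subsetP sAG sG e /sAG/sG. Qed.

Lemma edge_pair G e : simple_graph G -> e \in G ->
  exists u w, e = [set u; w] /\ u != w.
Proof.
move=> sG /sG e2.
have /cards2P[u [w [uw ->]]] : #|e| == 2 by rewrite e2.
by exists u, w.
Qed.

Lemma card_simple_graph G : simple_graph G -> (#|G| <= #|T| ^ 2)%N.
Proof.
move=> sG; have: G \subset [set [set p.1; p.2] | p : T * T].
  apply/subsetP => e /(edge_pair sG)[u [w [-> _]]].
  by apply/imsetP; exists (u, w).
move/subset_leq_card => /leq_trans; apply.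
by apply: leq_trans (leq_imset_card _ _) _; rewrite card_prod mulnn.
Qed.

Lemma leq_deg_card G v : (deg G v <= #|G|)%N.
Proof. by apply: subset_leq_card; apply/subsetP => e; rewrite inE => /andP[]. Qed.

Lemma degE G v : deg G v = (\sum_(e in G) (v \in e))%N.
Proof.
rewrite /deg -sum1_card.
under eq_bigl do rewrite inE.
by rewrite big_mkcondr; apply: eq_bigr => e _; case: ifP.
Qed.

(** Both sides are the degree of [v] in the union of [A] and [B]. *)
Lemma deg_setD A B v :
  (deg A v + deg (B :\: A) v = deg B v + deg (A :\: B) v)%N.
Proof.
have degID X Y : deg X v = (deg (X :&: Y) v + deg (X :\: Y) v)%N.
  by rewrite !degE (big_setID Y).
by rewrite (degID A B) (degID B A) setIC -!addnA (addnC (deg (A :\: B) v)).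
Qed.

Lemma sum_deg P G :
  (\sum_(v in P) deg G v = \sum_(e in G) \sum_(v in e) (v \in P))%N.
Proof.
under eq_bigr do rewrite degE.
rewrite exchange_big; apply: eq_bigr => e _ /=.
rewrite big_mkcond [RHS]big_mkcond /=; apply: eq_bigr => v _.
by case: (v \in P); case: (v \in e).
Qed.

(** Each edge is counted once per endpoint in [P] on the left and once per endpoint in [N] on the
    right. Sending an endpoint in [P] to the opposite endpoint is injective on each edge and lands
    in [N]. *)
Lemma leq_sum_deg P N G : simple_graph G ->
  (forall u w, [set u; w] \in G -> u \in P -> w \in N) ->
  (\sum_(v in P) deg G v <= \sum_(v in N) deg G v)%N.
Proof.
move=> sG PN; rewrite !sum_deg; apply: leq_sum => e eG.
have [u [w [eE uw]]] := edge_pair sG eG; rewrite {}eE in eG *.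
rewrite !big_setU1 ?inE //= !big_set1 addnC leq_add //.
  have := PN w u; rewrite setUC => /(_ eG); case: (w \in P) => // -> //.
by have := PN u w eG; case: (u \in P) => // -> //.
Qed.

Lemma leq_card_sum_deg G : simple_graph G -> (#|G| <= \sum_v deg G v)%N.
Proof.
move=> sG; have := sum_deg setT G.
under eq_bigl do rewrite inE.
move=> ->; rewrite -sum1_card; apply: leq_sum => e /sG e2.
by under eq_bigr do rewrite inE; rewrite sum1_card e2.
Qed.

Lemma deg_setU1 G u w : u != w -> [set u; w] \notin G ->
  forall v, deg ([set u; w] |: G) v = (deg G v + (v \in [set u; w]))%N.
Proof. by move=> uw eG v; rewrite !degE big_setU1 //= addnC. Qed.

(** Only the two endpoints change, and [(d + 1)^2 - d^2 = 2 d + 1] at each. *)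
Lemma sum_sqr_deg_setU1 G u w : u != w -> [set u; w] \notin G ->
  (\sum_v deg ([set u; w] |: G) v ^ 2 =
   \sum_v deg G v ^ 2 + (2 * (deg G u + deg G w) + 2))%N.
Proof.
move=> uw eG.
have split (f : T -> nat) : (\sum_v f v =
    f u + (f w + \sum_(v | (v != u) && (v != w)) f v))%N.
  by rewrite (bigD1 u) //= (bigD1 w) //= eq_sym.
rewrite !split !deg_setU1 // !inE !eqxx orbT.
rewrite [X in (_ + (_ + X) = _)%N](eq_bigr (fun v => deg G v ^ 2)%N); last first.
  by move=> v /andP[/negPf vu /negPf vw]; rewrite deg_setU1 // !inE vu vw addn0.
move: (\sum_(_ | _) _)%N => s; rewrite -!mulnn; lia.
Qed.

End Graph.

(** * EDCSs: existence, closeness of degrees, vertices of high degree *)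

Section Edcs.
Variables (R : realType) (T : finType).
Implicit Types (A B C G H : {set {set T}}) (F M S : {set T}).

(* A maximizer of [2 (beta - 1) |H| - \sum_v deg H v ^ 2] among the subgraphs of
   [G] is an EDCS: adding or removing one edge does not increase it. *)
Lemma EDCS_exists G (beta beta_minus : R) :
  simple_graph G -> beta_minus <= beta - 2 -> exists H, EDCS G beta beta_minus H.
Proof.
move=> sG bb.
pose phi H : R := 2 * (beta - 1) * #|H|%:R - (\sum_v deg H v ^ 2)%N%:R.
pose H := [arg max_(H > (set0 : {set {set T}}) | H \subset G) phi H]%O.
have [sHG Hmax] : H \subset G /\ forall H', H' \subset G -> phi H' <= phi H.
  by rewrite /H; case: arg_maxP => [|H' ? ?]; rewrite ?sub0set.
have phiU1 u w (K : {set {set T}}) : u != w -> [set u; w] \notin K ->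
    phi ([set u; w] |: K) = phi K + 2 * (beta - 1)
      - (2 * (deg K u + deg K w) + 2)%N%:R.
  move=> uw eK; rewrite /phi sum_sqr_deg_setU1 // cardsU1 eK add1n -natr1 natrD; lra.
have neq u w : [set u; w] \in G -> u != w.
  by move=> /sG; rewrite cards2; case: eqP.
exists H; split=> // u w.
(* Without the edge the degree sum of its endpoints is at most [beta - 2], and the edge itself adds
   2: the coefficient [beta - 1] is tuned to give exactly [beta] here, and the bound [beta - 2] for
   insertion below. *)
- move=> eH; have eG := subsetP sHG _ eH; have uw := neq _ _ eG.
  have eK : [set u; w] \notin H :\ [set u; w] by rewrite !inE eqxx.
  have HE := setD1K eH.
  have := phiU1 _ _ _ uw eK; have degE := deg_setU1 uw eK; rewrite HE in degE *.
  have := Hmax _ (subset_trans (subD1set H [set u; w]) sHG).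
  rewrite !degE !inE !eqxx orbT !(natrM, natrD) /=; lra.
- rewrite inE => /andP[eH eG]; have uw := neq _ _ eG.
  have := Hmax ([set u; w] |: H); rewrite phiU1 //.
  rewrite subUset sub1set eG sHG => /(_ isT).
  rewrite !(natrM, natrD); lra.
Qed.

Lemma EDCS_deg_le G (beta beta_minus : R) C v : simple_graph G -> 0 <= beta ->
  EDCS G beta beta_minus C -> (deg C v)%:R <= beta.
Proof.
move=> sG b0 [sCG P1 _]; have [->//|] := posnP (deg C v).
rewrite card_gt0 => /set0Pn[e]; rewrite inE => /andP[eC].
have [u [w [eE _]]] := edge_pair (simple_graphS sCG sG) eC.
rewrite {}eE in eC *; have := P1 _ _ eC; rewrite natrD => ub.
have := ler0n R (deg C u); have := ler0n R (deg C w).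
by rewrite !inE => ? ? /orP[]/eqP->; lra.
Qed.

(** The set of vertices with surplus above [th] is measured by its edges in [A :\: B] rather than by
    its cardinality, since edges are what carries a surplus of [A] over to a surplus of [B]. *)
Definition excess A B (th : R) : nat :=
  \sum_(v in [set v | th < (deg A v)%:R - (deg B v)%:R]) deg (A :\: B) v.

Lemma excess_le A B th : simple_graph A -> (excess A B th <= #|T| ^ 3)%N.
Proof.
move=> sA; apply: (@leq_trans (\sum_(v : T) #|T| ^ 2)); last first.
  by rewrite sum_nat_const.
rewrite /excess big_mkcond; apply: leq_sum => v _ /=.
case: ifP => // _; apply: leq_trans (leq_deg_card _ _) _.
exact: card_simple_graph (simple_graphS (subsetDl _ _) sA).
Qed.

(* An edge of [A :\: B] at a vertex where [deg A - deg B > th] leads to a vertex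
   where [deg B - deg A > th - g], at which [B :\: A] has a surplus. *)
Lemma excess_step A B (th g q D : R) : simple_graph A ->
  (forall u w, [set u; w] \in A :\: B ->
     (deg A u + deg A w)%:R - (deg B u + deg B w)%:R <= g) ->
  (forall v, (deg A v)%:R <= D) -> 0 <= q -> q * D <= th - g ->
  (1 + q) * (excess A B th)%:R <= (excess B A (th - g))%:R.
Proof.
move=> sA AB AD q0 qD.
set N := [set v | th - g < (deg B v)%:R - (deg A v)%:R].
have le1 : (excess A B th <= \sum_(v in N) deg (A :\: B) v)%N.
  apply: leq_sum_deg (simple_graphS (subsetDl _ _) sA) _ => u w /AB.
  by rewrite !inE !natrD; lra.
apply: (@le_trans _ _ ((1 + q) * (\sum_(v in N) deg (A :\: B) v)%N%:R)).
  by rewrite ler_wpM2l ?ler_nat //; lra.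
rewrite /excess -/N !natr_sum mulr_sumr; apply: ler_sum => v; rewrite inE => vN.
have := congr1 (fun m => m%:R : R) (deg_setD A B v); rewrite !natrD => degAB.
(* On [N], the degree in [B :\: A] exceeds the one in [A :\: B] by more than [th - g]; as the latter
   is at most [D], this additive gain is worth a factor [1 + q]. *)
suff : q * (deg (A :\: B) v)%:R <= th - g by lra.
apply: le_trans qD; rewrite ler_wpM2l //; apply: le_trans (AD v).
by rewrite ler_nat !degE [leqRHS](big_setID B) leq_addl.
Qed.

(** [excess_step] is iterated [t] times, exchanging [A] and [B] and lowering the threshold by [g]
    each time. The last hypothesis keeps every threshold reached at least [q * D]. *)
Lemma excess_growth (g q D : R) t : 0 <= g -> 0 <= q ->
  forall A B th, simple_graph A -> simple_graph B ->
  (forall u w, [set u; w] \in A :\: B ->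
     (deg A u + deg A w)%:R - (deg B u + deg B w)%:R <= g) ->
  (forall u w, [set u; w] \in B :\: A ->
     (deg B u + deg B w)%:R - (deg A u + deg A w)%:R <= g) ->
  (forall v, (deg A v)%:R <= D) -> (forall v, (deg B v)%:R <= D) ->
  q * D <= th - t%:R * g ->
  (1 + q) ^+ t * (excess A B th)%:R <= (#|T| ^ 3)%N%:R.
Proof.
move=> g0 q0; elim: t => [|t IH] A B th sA sB AB BA AD BD.
  by rewrite mul0r subr0 expr0 mul1r ler_nat excess_le.
rewrite -natr1 mulrDl mul1r => qD; rewrite exprSr -mulrA.
have tg : 0 <= t%:R * g by rewrite mulr_ge0.
apply: le_trans (IH B A (th - g) sB sA BA AB BD AD _); last by lra.
rewrite ler_wpM2l ?exprn_ge0 ?addr_ge0 //.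
by apply: (excess_step sA AB AD q0); lra.
Qed.

(** A vertex violating the conclusion has an edge in [A :\: B], so the initial excess is at least 1,
    and its growth would pass the trivial bound [#|T| ^ 3]. *)
Lemma deg_dist A B (th g q D : R) t : 0 <= g -> 0 <= q -> 0 <= th ->
  simple_graph A -> simple_graph B ->
  (forall u w, [set u; w] \in A :\: B ->
     (deg A u + deg A w)%:R - (deg B u + deg B w)%:R <= g) ->
  (forall u w, [set u; w] \in B :\: A ->
     (deg B u + deg B w)%:R - (deg A u + deg A w)%:R <= g) ->
  (forall v, (deg A v)%:R <= D) -> (forall v, (deg B v)%:R <= D) ->
  q * D <= th - t%:R * g -> (#|T| ^ 3)%N%:R < (1 + q) ^+ t ->
  forall v, (deg A v)%:R - (deg B v)%:R <= th.
Proof.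
move=> g0 q0 th0 sA sB AB BA AD BD qD qt v; rewrite leNgt; apply/negP => vth.
have := excess_growth g0 q0 sA sB AB BA AD BD qD; rewrite leNgt => /negP; apply.
apply: lt_le_trans qt _; rewrite ler_peMr ?exprn_ge0 ?addr_ge0 // ler1n.
rewrite /excess (bigD1 v) ?inE //=; apply: leq_trans (leq_addr _ _).
have := congr1 (fun m => m%:R : R) (deg_setD A B v); rewrite !natrD => degAB.
have := ler0n R (deg (B :\: A) v).
by rewrite -(ltr_nat R); lra.
Qed.

(** On an edge of the symmetric difference, (P1) in the subgraph containing it and (P2) in the other
    bound the gap of the degree sums by [g]. *)
Lemma deg_dist_EDCS G A B (a a' b b' th g q D : R) t :
  simple_graph G -> EDCS G a a' A -> EDCS G b b' B ->
  0 <= g -> 0 <= q -> 0 <= th -> a - b' <= g -> b - a' <= g ->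
  0 <= a <= D -> 0 <= b <= D ->
  q * D <= th - t%:R * g -> (#|T| ^ 3)%N%:R < (1 + q) ^+ t ->
  forall v, `|(deg A v)%:R - (deg B v)%:R| <= th.
Proof.
move=> sG eA eB g0 q0 th0 ab ba /andP[a0 aD] /andP[b0 bD] qD qt v.
have AD u := le_trans (EDCS_deg_le u sG a0 eA) aD.
have BD u := le_trans (EDCS_deg_le u sG b0 eB) bD.
case: eA eB => [sAG A1 A2] [sBG B1 B2].
have [sA sB] := (simple_graphS sAG sG, simple_graphS sBG sG).
have AB u w : [set u; w] \in A :\: B ->
    (deg A u + deg A w)%:R - (deg B u + deg B w)%:R <= g.
  rewrite inE => /andP[eB eA]; have := A1 _ _ eA.
  have := B2 u w; rewrite inE eB (subsetP sAG) // => /(_ isT); lra.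
have BA u w : [set u; w] \in B :\: A ->
    (deg B u + deg B w)%:R - (deg A u + deg A w)%:R <= g.
  rewrite inE => /andP[eA eB]; have := B1 _ _ eB.
  have := A2 u w; rewrite inE eA (subsetP sBG) // => /(_ isT); lra.
have := deg_dist g0 q0 th0 sA sB AB BA AD BD qD qt v.
have := deg_dist g0 q0 th0 sB sA BA AB BD AD qD qt v.
by rewrite ler_norml => ? ?; apply/andP; split; lra.
Qed.

(* All [C]-edges at [F :\: M] lead to vertices of [M] whose degree is at most
   about [beta / 2], so that [F :\: M] is hardly larger than [M]. *)
Lemma card_high_deg C F M (beta x eps : R) : simple_graph C ->
  (forall u w, [set u; w] \in C -> (deg C u + deg C w)%:R <= beta) ->
  vertex_cover C M -> 0 < x <= beta -> beta - x <= (1 + eps) * x ->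
  (forall v, v \in F -> x <= (deg C v)%:R) ->
  #|F :\: M|%:R <= (1 + eps) * #|M|%:R.
Proof.
move=> sC P1 covM /andP[x0 xb] bx Fx.
pose N := [set w in M | (deg C w)%:R <= beta - x].
have le1 : (\sum_(v in F :\: M) deg C v <= \sum_(v in N) deg C v)%N.
  apply: leq_sum_deg => // u w eC; rewrite !inE => /andP[uM uF].
  have [z] := covM _ eC; rewrite !inE => /orP[]/eqP-> zM; first by rewrite zM in uM.
  rewrite zM /=; have := P1 _ _ eC; have := Fx _ uF; rewrite natrD; lra.
have le2 : #|F :\: M|%:R * x <= #|M|%:R * (beta - x).
  apply: (@le_trans _ _ (\sum_(v in N) deg C v)%N%:R).
    apply: le_trans _ (_ : (\sum_(v in F :\: M) deg C v)%N%:R <= _).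
      rewrite natr_sum mulr_natl -sumr_const; apply: ler_sum => v.
      by rewrite inE => /andP[_ /Fx].
    by rewrite ler_nat.
  apply: (@le_trans _ _ (#|N|%:R * (beta - x))).
    rewrite natr_sum mulr_natl -sumr_const; apply: ler_sum => v.
    by rewrite inE => /andP[].
  rewrite ler_wpM2r ?subr_ge0 // ler_nat subset_leq_card //.
  by apply/subsetP => v; rewrite inE => /andP[].
rewrite -(ler_pM2r x0); apply: le_trans le2 _.
by rewrite mulrAC [leRHS]mulrC ler_wpM2l.
Qed.

End Edcs.

(** * Expectations over the random partition *)

Section Partition.
Variables (R : realType) (T : finType) (E : {set {set T}}) (k : nat).
Hypothesis k_gt0 : (0 < k)%N.

Definition expect (Z : partition_of E k -> R) : R :=
  \sum_f (\prod_(x : edge E) k%:R^-1) * Z f.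

Let kR_gt0 : 0 < k%:R :> R. Proof. by rewrite ltr0n. Qed.

(** Independence of the edges, by distributing the product over the sums. *)
Lemma expect_prod (g : edge E -> 'I_k -> R) :
  expect (fun f => \prod_x g x (f x)) = \prod_x (k%:R^-1 * \sum_j g x j).
Proof.
under [RHS]eq_bigr do rewrite mulr_sumr.
rewrite bigA_distr_bigA; apply: eq_bigr => f _.
by rewrite -big_split.
Qed.

Lemma expect1 : expect (fun=> 1) = 1.
Proof.
transitivity (expect (fun f => \prod_x (fun _ _ => 1) x (f x))).
  by apply: eq_bigr => f _; congr (_ * _); rewrite big1.
rewrite (expect_prod (fun _ _ => 1)) big1 // => x _.
by rewrite sumr_const card_ord mulVf // gt_eqF.
Qed.

Lemma expect_cst c : expect (fun=> c) = c.
Proof.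
rewrite -[RHS]mul1r -expect1 mulr_suml.
by apply: eq_bigr => f _; rewrite mulr1.
Qed.

Lemma expectD Y Z : expect (fun f => Y f + Z f) = expect Y + expect Z.
Proof. by rewrite -big_split; apply: eq_bigr => f _; rewrite mulrDr. Qed.

Lemma expectMl c Z : expect (fun f => c * Z f) = c * expect Z.
Proof. by rewrite mulr_sumr; apply: eq_bigr => f _; rewrite mulrCA. Qed.

Lemma expect_sum (I : finType) (Z : I -> partition_of E k -> R) :
  expect (fun f => \sum_i Z i f) = \sum_i expect (Z i).
Proof.
by rewrite exchange_big; apply: eq_bigr => f _; rewrite mulr_sumr.
Qed.

(** Markov's inequality: [Z] dominates the indicator of the failure of [A]. *)
Lemma Pr_partition_ge (A : partition_of E k -> Prop) (Z : partition_of E k -> R) :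
  (forall f, 0 <= Z f) -> (forall f, ~ A f -> 1 <= Z f) ->
  1 - expect Z <= Pr_partition R A.
Proof.
move=> Z0 Z1; rewrite lerBlDr -expect1 /Pr_partition /expect [leRHS]addrC.
rewrite (bigID (fun f => `[< A f >])) /= addrC.
have w0 : 0 <= \prod_(x : edge E) k%:R^-1 :> R.
  by apply: prodr_ge0 => x _; rewrite invr_ge0 ltW.
apply: lerD; last by under eq_bigr do rewrite mulr1.
rewrite [leRHS](bigID (fun f => `[< A f >])) /= addrC.
rewrite -[leLHS]addr0; apply: lerD; last by apply: sumr_ge0 => f _; rewrite mulr_ge0.
by apply: ler_sum => f /asboolPn nA; rewrite ler_wpM2l // Z1.
Qed.

Lemma le_Pr_partition (A B : partition_of E k -> Prop) :
  (forall f, A f -> B f) -> Pr_partition R A <= Pr_partition R B.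
Proof.
move=> AB; rewrite /Pr_partition big_mkcond [leRHS]big_mkcond /=.
have w0 : 0 <= \prod_(x : edge E) k%:R^-1 :> R.
  by apply: prodr_ge0 => x _; rewrite invr_ge0 ltW.
apply: ler_sum => f _; case: asboolP => [/AB Bf|_]; first by rewrite asboolT.
by case: ifP.
Qed.

Lemma sum_edge (K : {set {set T}}) (F : {set T} -> nat) : K \subset E ->
  (\sum_(e in K) F e = \sum_(x : edge E | val x \in K) F (val x))%N.
Proof.
move=> /subsetP sKE.
have -> : K = [set val x | x in [set x : edge E | val x \in K]].
  apply/setP => e; apply/idP/imsetP => [eK|[x + ->]]; last by rewrite inE.
  by exists (exist _ e (sKE _ eK)); rewrite ?inE.
rewrite big_imset /=; last by move=> x y _ _; apply: val_inj.
by apply: eq_bigl => x; rewrite inE mem_imset ?inE //; apply: val_inj.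
Qed.

Lemma deg_piece (H : {set {set T}}) f (i : 'I_k) v : H \subset E ->
  deg (H :&: piece f i) v =
  (\sum_(x : edge E | (val x \in H) && (v \in val x)) (f x == i))%N.
Proof.
move=> sHE; rewrite degE sum_edge; last by rewrite subIset // sHE.
rewrite big_mkcond [RHS]big_mkcond; apply: eq_bigr => x _.
rewrite inE mem_imset ?inE; last exact: val_inj.
by case: (val x \in H); case: (v \in val x); case: (f x == i).
Qed.

(** The degree in a piece is binomial with [deg H v] trials of success probability [1 / k]; the
    right side is its moment generating function. *)
Lemma mgf_deg_piece (H : {set {set T}}) (i : 'I_k) v (s : R) : H \subset E ->
  expect (fun f => expR (s * (deg (H :&: piece f i) v)%:R)) =
  (1 + (expR s - 1) / k%:R) ^+ deg H v.
Proof.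
move=> sHE.
pose c (x : edge E) := (val x \in H) && (v \in val x).
pose g x j := if c x && (j == i) then expR s else 1.
transitivity (expect (fun f => \prod_x g x (f x))).
  apply: eq_bigr => f _; congr (_ * _); rewrite deg_piece // natr_sum mulr_sumr.
  rewrite expR_sum big_mkcond; apply: eq_bigr => x _; rewrite -/(c x).
  by rewrite /g; case: (c x); case: (f x == i); rewrite //= ?mulr1 // mulr0 expR0.
rewrite expect_prod degE (sum_edge _ sHE) -big_mkcondr sum1_card -prodr_const.
rewrite [RHS]big_mkcond; apply: eq_bigr => x _; rewrite /g.
have -> : (x \in [pred i0 | (val i0 \in H) && (v \in val i0)]) = c x by [].
case: (c x) => /=; last by rewrite sumr_const card_ord mulVf // gt_eqF.
rewrite (bigD1 i) //= eqxx (eq_bigr (fun=> 1)); last by move=> j /negPf->.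
rewrite sumr_const cardC1 card_ord -subn1 natrB //.
by field; rewrite gt_eqF.
Qed.

Lemma mgf_deg_piece_le (H : {set {set T}}) (i : 'I_k) v (s : R) : H \subset E ->
  expect (fun f => expR (s * (deg (H :&: piece f i) v)%:R)) <=
  expR ((expR s - 1) * ((deg H v)%:R / k%:R)).
Proof.
move=> sHE; rewrite mgf_deg_piece //.
have -> : (expR s - 1) * ((deg H v)%:R / k%:R) =
    (deg H v)%:R * ((expR s - 1) / k%:R) by ring.
rewrite expRM_natl; apply: lerXn2r; rewrite ?nnegrE ?expR_ge0 ?expR_ge1Dx //.
have -> : 1 + (expR s - 1) / k%:R = (k%:R - 1) / k%:R + expR s / k%:R.
  by field; rewrite gt_eqF.
by rewrite addr_ge0 // divr_ge0 ?expR_ge0 ?subr_ge0 ?ler1n // ltW.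
Qed.

End Partition.

(** * Exponential inequalities and Chernoff tail bounds *)

Lemma expR_le_quad (R : realType) (s : R) : 0 <= s <= 1 / 2 ->
  expR s <= 1 + s + 2 * s ^+ 2.
Proof.
move=> /andP[s0 s1]; have s1_gt0 : 0 < 1 - s by lra.
rewrite -(ler_pM2l s1_gt0); apply: (@le_trans _ _ 1).
  rewrite -[leRHS](expRxMexpNx_1 s) mulrC ler_wpM2l ?expR_ge0 //.
  exact: expR_ge1Dx.
(* The product [(1 - s) (1 + s + 2 s^2)] equals [1 + s^2 (1 - 2 s)], hence the restriction to
   [s <= 1 / 2]. *)
by nra.
Qed.

Lemma expRN_le_quad (R : realType) (s : R) : 0 <= s ->
  expR (- s) <= 1 - s + 2 * s ^+ 2.
Proof.
move=> s0; have s1_gt0 : 0 < 1 + s by lra.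
rewrite -(ler_pM2l s1_gt0); apply: (@le_trans _ _ 1).
  rewrite -[leRHS](expRxMexpNx_1 s) ler_wpM2r ?expR_ge0 //.
  exact: expR_ge1Dx.
by nra.
Qed.

Lemma expR_sub1_le (R : realType) (y : R) : expR y - 1 <= y * expR y.
Proof.
have := expR_ge1Dx (- y); rewrite -(ler_pM2r (expR_gt0 y)) mulrDl.
by rewrite [expR (- y) * _]mulrC expRxMexpNx_1; lra.
Qed.

(** With [y = (expR s - 1) * (d / k)], the bound [expR y - 1 <= y * expR y] produces a factor
    [d / k], which turns the sum over [k] pieces into a factor [d <= N]. *)
Lemma upper_tail_bound (R : realType) (k d s a b N : R) :
  0 < k -> 0 <= d <= N -> d / k <= b -> 0 <= s <= 1 / 2 -> 2 <= expR (s * a) ->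
  k * ((expR ((expR s - 1) * (d / k)) - 1) / (expR (s * (d / k + a)) - 1)) <=
  2 * N * expR (2 * s ^+ 2 * b - s * a).
Proof.
move=> k0 /andP[d0 dN] mub s01 sa; have /andP[s0 s1] := s01.
set mu := d / k in mub *; have mu0 : 0 <= mu by rewrite divr_ge0 // ltW.
have es0 : 0 <= expR s - 1 by rewrite subr_ge0 -expR0 ler_expR.
have es1 : expR s - 1 <= s + 2 * s ^+ 2 by have := expR_le_quad s01; lra.
have s2 : s + 2 * s ^+ 2 <= 1 by nra.
set y := (expR s - 1) * mu.
have yE : y <= s * mu + 2 * s ^+ 2 * b.
  apply: (@le_trans _ _ ((s + 2 * s ^+ 2) * mu)); first by rewrite ler_wpM2r.
  by rewrite mulrDl lerD2l ler_wpM2l // mulr_ge0 // sqr_ge0.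
(* Since [expR (s * a) >= 2], subtracting 1 in the denominator costs at most a factor 2. *)
have den : expR (s * mu) * expR (s * a) <= 2 * (expR (s * (mu + a)) - 1).
  rewrite [s * (_ + _)]mulrDr expRD.
  have : 1 <= expR (s * mu) by rewrite -expR0 ler_expR mulr_ge0.
  by nra.
have den0 : 0 < expR (s * (mu + a)) - 1.
  by have := expR_gt0 (s * mu); have := expR_gt0 (s * a); nra.
rewrite mulrA ler_pdivrMr //.
apply: (@le_trans _ _ (d * expR y)).
  apply: (@le_trans _ _ (k * (y * expR y))).
    by rewrite ler_wpM2l ?expR_sub1_le // ltW.
  have -> : k * (y * expR y) = (expR s - 1) * (d * expR y).
    by rewrite /y /mu; field; rewrite gt_eqF.
  by rewrite ler_piMl ?mulr_ge0 ?expR_ge0 //; lra.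
have N0 : 0 <= N := le_trans d0 dN.
apply: (@le_trans _ _ (N * expR (s * mu + 2 * s ^+ 2 * b))).
  by rewrite ler_pM ?expR_ge0 // ler_expR.
have -> : s * mu + 2 * s ^+ 2 * b = 2 * s ^+ 2 * b - s * a + (s * mu + s * a).
  by ring.
rewrite expRD [2 * N * _ * _](_ : _ = N * (expR (2 * s ^+ 2 * b - s * a) *
  (2 * (expR (s * (mu + a)) - 1)))); last by ring.
by do 2![rewrite ler_wpM2l ?expR_ge0 //]; rewrite expRD.
Qed.

(** From [1 <= a < d / k] follows [k <= d <= N], so the union over the pieces costs at most [N]. *)
Lemma lower_tail_bound (R : realType) (k d s a b N : R) :
  0 < k -> d <= N -> 1 <= a < d / k -> d / k <= b -> 0 <= s ->
  k * (expR (s * (d / k - a)) * expR ((expR (- s) - 1) * (d / k))) <=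
  N * expR (2 * s ^+ 2 * b - s * a).
Proof.
move=> k0 dN /andP[a1 amu] mub s0.
have kN : k <= N.
  apply: le_trans dN; rewrite -[leLHS]mul1r -ler_pdivlMr //.
  by apply: ltW; apply: le_lt_trans amu.
set mu := d / k in amu mub *; have mu0 : 0 <= mu by lra.
apply: ler_pM => //; rewrite ?mulr_ge0 ?expR_ge0 //; first exact: ltW.
rewrite -expRD ler_expR.
have : (expR (- s) - 1) * mu <= (- s + 2 * s ^+ 2) * mu.
  by rewrite ler_wpM2r //; have := expRN_le_quad s0; lra.
have : 2 * s ^+ 2 * mu <= 2 * s ^+ 2 * b.
  by rewrite ler_wpM2l // mulr_ge0 // sqr_ge0.
by lra.
Qed.

(* In the upper tail the weight is [expR (s X) - 1] rather than [expR (s X)]: its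
   expectation is of order [1 / k], which pays for the union bound over the [k]
   pieces. In the lower tail [k] is at most the number of edges. *)
Lemma deg_piece_concentration (R : realType) (T : finType) (E H : {set {set T}})
    (k : nat) (s a b : R) :
  (0 < k)%N -> simple_graph E -> H \subset E ->
  (forall v, (deg H v)%:R / k%:R <= b) ->
  1 <= a -> 0 <= s <= 1 / 2 -> 2 <= expR (s * a) ->
  1 - 3 * #|T|%:R ^+ 3 * expR (2 * s ^+ 2 * b - s * a) <=
  Pr_partition R (fun f : partition_of E k => forall v (i : 'I_k),
    `|(deg (H :&: piece f i) v)%:R - (deg H v)%:R / k%:R| <= a).
Proof.
move=> k_gt0 sE sHE Hb a1 s01 sa; have /andP[s0 _] := s01.
have k0 : 0 < k%:R :> R by rewrite ltr0n.
pose mu v : R := (deg H v)%:R / k%:R.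
have mu0 v : 0 <= mu v by rewrite divr_ge0.
pose X (f : partition_of E k) (i : 'I_k) v : R := (deg (H :&: piece f i) v)%:R.
pose U f i v := (expR (s * (mu v + a)) - 1)^-1 * (-1 + expR (s * X f i v)).
(* If [mu v <= a], the degree, being nonnegative, cannot fall below [mu v - a]; the weight is then
   0. *)
pose L f i v :=
  (if a < mu v then expR (s * (mu v - a)) else 0) * expR (- s * X f i v).
have den0 v : 0 < expR (s * (mu v + a)) - 1.
  rewrite mulrDr expRD; have := expR_gt0 (s * a).
  have : 1 <= expR (s * mu v) by rewrite -expR0 ler_expR mulr_ge0.
  by nra.
have U0 f i v : 0 <= U f i v.
  rewrite /U mulr_ge0 //; first by rewrite invr_ge0 ltW.
  by rewrite addrC subr_ge0 -expR0 ler_expR mulr_ge0.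
have L0 f i v : 0 <= L f i v.
  by rewrite mulr_ge0 ?expR_ge0 //; case: ifP; rewrite ?expR_ge0.
pose N : R := #|T|%:R ^+ 2.
have dN v : (deg H v)%:R <= N.
  rewrite /N -natrX ler_nat; apply: leq_trans (leq_deg_card _ _) _.
  exact: card_simple_graph (simple_graphS sHE sE).
apply: le_trans (Pr_partition_ge k_gt0
  (Z := fun f => \sum_v \sum_i (U f i v + L f i v)) _ _).
- rewrite lerD2l lerN2 expect_sum.
  under eq_bigr do rewrite expect_sum.
  (* Each vertex contributes [2 * N] from the upper tail and [N] from the lower one. *)
  have -> : 3 * #|T|%:R ^+ 3 * expR (2 * s ^+ 2 * b - s * a) =
      \sum_(v : T) (3 * N * expR (2 * s ^+ 2 * b - s * a)).
    by rewrite sumr_const -mulr_natl /N; ring.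
  apply: ler_sum => v _.
  apply: (@le_trans _ _ (\sum_(i < k)
     ((expR (s * (mu v + a)) - 1)^-1 * (-1 + expR ((expR s - 1) * mu v))
     + (if a < mu v then expR (s * (mu v - a)) else 0)
        * expR ((expR (- s) - 1) * mu v)))).
    apply: ler_sum => i _.
    rewrite expectD expectMl expectD !expectMl expect_cst //.
    apply: lerD; rewrite ler_wpM2l ?lerD2l ?mgf_deg_piece_le //.
    - by rewrite invr_ge0 ltW.
    - by case: ifP; rewrite ?expR_ge0.
  rewrite sumr_const card_ord -[leLHS]mulr_natl [k%:R * _]mulrDr.
  have := upper_tail_bound k0 (introT andP (conj (ler0n _ _) (dN v))) (Hb v) s01 sa.
  rewrite -/(mu v) [-1 + _]addrC [_^-1 * _]mulrC => up.
  suff : k%:R * ((if a < mu v then expR (s * (mu v - a)) else 0) *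
      expR ((expR (- s) - 1) * mu v)) <= N * expR (2 * s ^+ 2 * b - s * a) by lra.
  case: ifP => [amu|_]; last by rewrite mul0r mulr0 mulr_ge0 ?expR_ge0 ?sqr_ge0.
  by apply: lower_tail_bound => //; apply/andP; split.
- by move=> f; apply: sumr_ge0 => v _; apply: sumr_ge0 => i _; rewrite addr_ge0.
- move=> f /existsNP[v /existsNP[i /negP]]; rewrite -ltNge => bad.
  rewrite (bigD1 v) //= (bigD1 i) //=.
  have S0 : 0 <= \sum_(j | j != i) (U f j v + L f j v).
    by apply: sumr_ge0 => j _; rewrite addr_ge0.
  have S1 : 0 <= \sum_(u | u != v) \sum_j (U f j u + L f j u).
    by apply: sumr_ge0 => u _; apply: sumr_ge0 => j _; rewrite addr_ge0.
  suff : 1 <= U f i v + L f i v by lra.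
  have := U0 f i v; have := L0 f i v.
  move: bad; rewrite lter_normr -/(mu v) -/(X f i v) => /orP[bad|bad] L00 U00.
    suff : 1 <= U f i v by lra.
    rewrite /U mulrC ler_pdivlMr // mul1r addrC lerD2l ler_expR ler_wpM2l //; lra.
  suff : 1 <= L f i v by lra.
  have X0 : 0 <= X f i v by rewrite ler0n.
  rewrite /L ifT; last by lra.
  rewrite -expRD -expR0 ler_expR mulNr -mulrBr mulr_ge0 //; lra.
Qed.

Lemma piece_sub (T : finType) (E : {set {set T}}) k (f : partition_of E k) i :
  piece f i \subset E.
Proof. by apply/subsetP => e /imsetP[x _ ->]; exact: valP. Qed.

(** * Deterministic guarantees for a partition on which the degrees of [H] concentrate *)

Section Approximation.
Variables (R : realType) (T : finType) (E H : {set {set T}}) (k : nat).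
Variables (eps lambda beta : R) (t : nat) (f : partition_of E k).
Hypotheses (sE : simple_graph E) (k_gt0 : (0 < k)%N) (eps01 : 0 < eps < 1).
Hypotheses (lambda_bound : 0 < lambda <= eps / 64) (beta_gt0 : 0 < beta).
Hypothesis edcsH : EDCS E (k%:R * beta) ((1 - lambda) * (k%:R * beta)) H.
Hypothesis conc : forall v (i : 'I_k),
  `|(deg (H :&: piece f i) v)%:R - (deg H v)%:R / k%:R| <= lambda * beta.
Hypothesis t_bound : 3 * lambda * t%:R <= eps / 128.
Hypothesis t_growth : (#|T| ^ 3)%N%:R < (1 + eps / 256) ^+ t.

Let kR_gt0 : 0 < k%:R :> R. Proof. by rewrite ltr0n. Qed.

(** After division by [k], each of the two endpoints deviates by at most [lambda * beta], which
    widens both bounds by [2 * lambda * beta]. *)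
Lemma EDCS_setI_piece i :
  EDCS (piece f i) ((1 + 2 * lambda) * beta) ((1 - 3 * lambda) * beta)
    (H :&: piece f i).
Proof.
case: edcsH => sHE P1 P2; split=> [|u w|u w]; first exact: subsetIr.
- rewrite inE => /andP[/P1 + _].
  rewrite -ler_pdivrMl // mulrC natrD mulrDl => le_beta.
  move: (conc u i) (conc w i); rewrite !ler_norml natrD; lra.
- rewrite !inE => /andP[+ eP]; rewrite eP andbT => eH.
  have := P2 u w; rewrite inE eH (subsetP (piece_sub f i)) // => /(_ isT).
  rewrite mulrCA -ler_pdivlMl // mulrC natrD mulrDl => le_beta.
  move: (conc u i) (conc w i); rewrite !ler_norml natrD; lra.
Qed.

Variables (C : 'I_k -> {set {set T}}) (F : 'I_k -> {set T}) (M : {set T}).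
Hypothesis outCF : forall i,
  edcs_vc_coreset beta ((1 - lambda) * beta) ((1 - 16^-1 * eps) * (beta / 2))
    (piece f i) (C i) (F i).

(** The reference value [deg H v / k] does not depend on [i], so this makes the degrees in all the
    [C i] comparable with each other. *)
Lemma deg_EDCS_piece i v :
  `|(deg (C i) v)%:R - (deg H v)%:R / k%:R| <= (eps / 64 + lambda) * beta.
Proof.
have [edcsC _] := outCF i.
have /andP[e0 e1] := eps01; have /andP[l0 l1] := lambda_bound.
have lb : 0 <= lambda * beta by rewrite mulr_ge0 // ltW.
have l1b : lambda * beta <= 1 / 64 * beta by rewrite ler_wpM2r ?(ltW beta_gt0) //; lra.
(* Both parameter gaps equal [3 * lambda * beta]. The threshold [eps / 64 * beta] splits into
   [eps / 128 * beta] for the [t] decrements and as much for [q * D]. *)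
have := @deg_dist_EDCS R T (piece f i) (C i) (H :&: piece f i) _ _ _ _
  (eps / 64 * beta) (3 * lambda * beta) (eps / 256) (2 * beta) t
  (simple_graphS (piece_sub f i) sE) edcsC (EDCS_setI_piece i).
have eb : 0 <= eps * beta by rewrite mulr_ge0 // ltW.
have tb := ler_wpM2r (ltW beta_gt0) t_bound.
move=> /(_ _ _ _ _ _ _ _ _ t_growth v) dist.
rewrite -(subrKA (deg (H :&: piece f i) v)%:R) mulrDl.
apply: le_trans (ler_normD _ _) (lerD (dist _ _ _ _ _ _ _ _) (conc v i)).
all: try (apply/andP; split); lra.
Qed.

Lemma coreset_vertex_cover :
  vertex_cover (\bigcup_i C i) M -> vertex_cover E ((\bigcup_i F i) :|: M).
Proof.
move=> covM e eE; have /andP[e0 e1] := eps01; have /andP[l0 l1] := lambda_bound.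
pose i := f (exist _ e eE).
have eP : e \in piece f i by apply/imsetP; exists (exist _ e eE); rewrite ?inE.
have [[_ _ P2] FE] := outCF i.
have [eC|eC] := boolP (e \in C i).
  have [|v ve vM] := covM e; first by apply/bigcupP; exists i.
  by exists v => //; rewrite inE vM orbT.
have [u [w [uwE _]]] := edge_pair sE eE.
have := P2 u w; rewrite -uwE inE eC eP => /(_ isT); rewrite natrD => ge_beta.
have high v : (1 - 16^-1 * eps) * (beta / 2) < (deg (C i) v)%:R ->
    v \in (\bigcup_i F i) :|: M.
  by move=> hv; rewrite inE; apply/orP; left; apply/bigcupP; exists i;
     rewrite // FE inE.
have lb : lambda * beta <= eps / 64 * beta by rewrite ler_wpM2r // ltW.
have eb : 0 < eps * beta by rewrite mulr_gt0.
(* Twice the threshold is [(1 - eps / 16) * beta], less than the [(1 - lambda) * beta] of (P2), so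
   one endpoint is above the threshold. *)
have [hu|hu] := ltP ((1 - 16^-1 * eps) * (beta / 2)) (deg (C i) u)%:R.
  by exists u; [rewrite uwE !inE eqxx | exact: high].
exists w; [by rewrite uwE !inE eqxx orbT | apply: high; lra].
Qed.

Lemma coreset_card S : min_vertex_cover (\bigcup_i C i) M -> vertex_cover E S ->
  #|(\bigcup_i F i) :|: M|%:R <= (2 + eps) * #|S|%:R.
Proof.
move=> [covM minM] covS; have /andP[e0 e1] := eps01.
have /andP[l0 l1] := lambda_bound.
have lb : lambda * beta <= eps / 64 * beta by rewrite ler_wpM2r // ltW.
have eb : 0 < eps * beta by rewrite mulr_gt0.
have e2b : eps ^+ 2 * beta <= eps * beta.
  by rewrite expr2 -mulrA ler_piMl // ltW.
have e1b : eps * beta <= beta by rewrite ler_piMl // ltW.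
have leMS : (#|M| <= #|S|)%N.
  apply: minM => e /bigcupP[i _ eC]; apply: covS.
  have [[sC _ _] _] := outCF i.
  exact: subsetP (subset_trans sC (piece_sub f i)) _ eC.
pose i0 := Ordinal k_gt0; have [[sC P1 _] _] := outCF i0.
have FM : #|(\bigcup_i F i) :\: M|%:R <= (1 + eps) * #|M|%:R :> R.
  (* Passing from [C j] to [C i0] through [H] loses at most [2 * (eps / 64 + lambda) * beta <= eps /
     16 * beta]; with the [eps / 32 * beta] of the threshold this stays within [eps / 8 * beta]. *)
  apply: (@card_high_deg _ _ (C i0) _ _ beta ((1 - eps / 4) * (beta / 2))) => //.
  - exact: simple_graphS (subset_trans sC (piece_sub f i0)) sE.
  - by move=> e eC; apply: covM; apply/bigcupP; exists i0.
  - apply/andP; split; lra.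
  - lra.
  - move=> v /bigcupP[j _]; have [_ ->] := outCF j; rewrite inE => hv.
    move: (deg_EDCS_piece j v) (deg_EDCS_piece i0 v); rewrite !ler_norml.
    lra.
have -> : #|(\bigcup_i F i) :|: M| = (#|(\bigcup_i F i) :\: M| + #|M|)%N.
  rewrite -(cardsID M) setIUl setIid (setUidPr (subsetIr _ _)).
  by rewrite setDUl setDv setU0 addnC.
apply: (@le_trans _ _ ((2 + eps) * #|M|%:R)); first by rewrite natrD; lra.
by rewrite ler_wpM2l ?ler_nat //; lra.
Qed.

End Approximation.

(** * Choice of the parameters and conclusion *)

Lemma ln_ge_half (R : realType) (x : R) : 2 <= x -> 1 / 2 <= ln x.
Proof.
move=> x2; have x0 : 0 < x by lra.
rewrite -ler_expR lnK ?posrE //; apply: le_trans x2.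
have := expRxMexpNx_1 (1 / 2 : R); have := expR_ge1Dx (- (1 / 2) : R).
have := expR_gt0 (1 / 2 : R); nra.
Qed.

(** The number [t] of growth steps is the largest that the first bound permits, of order
    [ln n ^+ 2 / eps]; about [ln n / eps] steps suffice for the growth. *)
Lemma growth_exponent (R : realType) (n eps lambda : R) : 2 <= n -> 0 < eps < 1 ->
  lambda = 8 ^- 7 * (eps / ln n) ^+ 2 ->
  exists t : nat, 3 * lambda * t%:R <= eps / 128 /\ n ^+ 3 < (1 + eps / 256) ^+ t.
Proof.
move=> n2 /andP[e0 e1] lE; have L2 := ln_ge_half n2; set L := ln n in lE L2.
have L0 : 0 < L by lra.
have l0 : 0 < lambda.
  by rewrite lE mulr_gt0 ?invr_gt0 ?exprn_gt0 // divr_gt0.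
pose r := eps / (384 * lambda); have r0 : 0 <= r by rewrite divr_ge0 //; lra.
exists (Num.truncn r); have /andP[tr rt] := truncn_itv r0.
split.
  apply: (@le_trans _ _ (3 * lambda * r)); first by rewrite ler_wpM2l //; lra.
  rewrite le_eqVlt; apply/orP; left; apply/eqP; rewrite /r; field.
  by rewrite gt_eqF.
have -> : n ^+ 3 = expR (3 * L) by rewrite expRM_natl lnK // posrE; lra.
have qe : expR (eps / 512) <= 1 + eps / 256.
  by have := @expR_le_quad _ (eps / 512) => /(_ _)/le_trans; apply; nra.
apply: lt_le_trans (_ : expR (eps / 512) ^+ Num.truncn r <= _); last first.
  by apply: lerXn2r; rewrite ?nnegrE ?expR_ge0 //; lra.
rewrite -expRM_natl ltr_expR.
have er : eps / 512 * r = 4096 / 384 * L ^+ 2.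
  by rewrite /r lE; field; rewrite !gt_eqF.
apply: (@lt_le_trans _ _ (eps / 512 * r - eps / 512)); last first.
  have rt' : r - 1 <= (Num.truncn r)%:R by move: rt; rewrite -natr1; lra.
  have e512 : 0 <= eps / 512 by lra.
  by have := ler_wpM2l e512 rt'; lra.
by rewrite er; nra.
Qed.

Theorem theorem5p3 (R : realType) :
  exists (c_lambda c_beta c_F c_size : R) (d : nat),
    [/\ 0 < c_lambda, 0 < c_beta, 0 < c_F, 0 < c_size & (0 < d)%N] /\
    forall (T : finType) (E : {set {set T}}) (k : nat) (eps : R),
      (1 < #|T|)%N -> simple_graph E -> (0 < k)%N -> 0 < eps < 1 ->
      let n : R := #|T|%:R in
      let lambda := c_lambda * (eps / ln n) ^+ 2 in
      let beta := c_beta * eps ^- 6 * ln n ^+ 7 in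
      randomized_composable_vc_coreset E k
        (@edcs_vc_coreset R T beta ((1 - lambda) * beta)
           ((1 - c_F * eps) * (beta / 2)))
        (2 + eps) (c_size * (n * beta)) (n ^- d).
Proof.
pose c : R := 8 ^- 7.
have c0 : 0 < c by rewrite invr_gt0 exprn_gt0.
have c1 : c <= 1 / 256.
  rewrite mul1r lef_pV2 ?posrE ?exprn_gt0 // -natrX ler_nat //.
(* The choice of [c_beta] makes [lambda ^+ 2 * beta] equal to [256 * ln n ^+ 3 / eps ^+ 2]. The size
   constant 2 accounts for at most [n * beta] edges and [n <= n * beta] vertices. *)
exists c, (256 / c ^+ 2), 16^-1, 2, 1%N; split.
  by split; rewrite ?invr_gt0 ?divr_gt0 ?exprn_gt0.
move=> T E k eps n_gt1 sE k_gt0 eps01 n lambda beta.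
have /andP[e0 e1] := eps01.
have n2 : 2 <= n by rewrite ler_nat.
have L2 := ln_ge_half n2; have L0 : 0 < ln n by lra.
have lambda0 : 0 < lambda by rewrite mulr_gt0 // exprn_gt0 // divr_gt0.
have lambda_le : lambda <= eps / 64.
  have : (eps / ln n) ^+ 2 <= 4 * eps.
    rewrite expr_div_n ler_pdivrMr ?exprn_gt0 //.
    have : 1 / 4 <= ln n ^+ 2 by nra.
    have : eps ^+ 2 <= eps by nra.
    by nra.
  have : 0 <= (eps / ln n) ^+ 2 by exact: sqr_ge0.
  rewrite /lambda; nra.
have beta0 : 0 < beta.
  by rewrite !mulr_gt0 ?invr_gt0 ?exprn_gt0.
have l2b : 64 * ln n <= lambda ^+ 2 * beta.
  have -> : lambda ^+ 2 * beta = 256 * ln n ^+ 3 / eps ^+ 2.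
    by rewrite /lambda /beta; field; rewrite !gt_eqF.
  rewrite ler_pdivlMr ?exprn_gt0 //.
  have : ln n * eps ^+ 2 <= ln n by rewrite ler_piMr ?(ltW L0) // expr_le1 // ltW.
  nra.
have [t [t1 t2]] := growth_exponent n2 eps01 (erefl lambda).
clearbody lambda beta.
have lb : lambda ^+ 2 * beta <= lambda * beta.
  by rewrite expr2 -mulrA ler_piMl ?mulr_ge0 ?(ltW beta0) ?(ltW lambda0) //; lra.
have lb1 : lambda * beta <= beta by rewrite ler_piMl ?(ltW beta0) //; lra.
split=> [G sG|G C F sG [edcsC ->]|].
(* Existence needs [lambda * beta >= 2], which follows from [64 * ln n <= lambda ^+ 2 * beta]. *)
- have [|H edcsH] := @EDCS_exists R T G beta ((1 - lambda) * beta) sG; first by lra.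
  by exists H, [set v | (1 - 16^-1 * eps) * (beta / 2) < (deg H v)%:R].
- rewrite natrD.
  have : #|C|%:R <= n * beta.
    have sC : simple_graph C by case: edcsC => sCG _ _; exact: simple_graphS sCG sG.
    apply: (@le_trans _ _ (\sum_v deg C v)%N%:R).
      by rewrite ler_nat leq_card_sum_deg.
    rewrite natr_sum mulr_natl -sumr_const; apply: ler_sum => v _.
    exact: EDCS_deg_le sG (ltW beta0) edcsC.
  have : #|[set v | (1 - 16^-1 * eps) * (beta / 2) < (deg C v)%:R]|%:R <= n.
    by rewrite ler_nat max_card.
  nra.
have kR0 : 0 < k%:R :> R by rewrite ltr0n.
have [H edcsH] : exists H, EDCS E (k%:R * beta) ((1 - lambda) * (k%:R * beta)) H.
  apply: EDCS_exists => //.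
  have : 1 <= k%:R :> R by rewrite ler1n.
  nra.
have [sHE _ _] := edcsH.
have Hb v : (deg H v)%:R / k%:R <= beta.
  rewrite ler_pdivrMr // mulrC; apply: EDCS_deg_le sE _ edcsH.
  by rewrite mulr_ge0 // ltW.
(* The value [s = lambda / 4] minimizes the exponent [2 * s ^+ 2 * beta - s * lambda * beta]; it
   becomes [- lambda ^+ 2 * beta / 8 <= - 8 * ln n], so the failure probability is at most
   [3 * n ^- 5]. *)
have s01 : 0 <= lambda / 4 <= 1 / 2 by apply/andP; split; lra.
have a1 : 1 <= lambda * beta by lra.
have sa : 2 <= expR (lambda / 4 * (lambda * beta)).
  apply: le_trans (expR_ge1Dx _); rewrite expr2 in l2b; lra.
apply: le_trans (le_trans (deg_piece_concentration k_gt0 sE sHE Hb a1 s01 sa) _).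
  rewrite lerD2l lerN2 expr1.
  apply: (@le_trans _ _ (3 * n ^+ 3 * expR (- (8%:R * ln n)))).
    rewrite ler_wpM2l ?mulr_ge0 ?exprn_ge0 // ler_expR; lra.
  rewrite expRN expRM_natl lnK ?posrE; last by lra.
  have n0 : 0 < n by lra.
  have n4 : 3 <= n ^+ 4.
    by apply: (@le_trans _ _ (2 ^+ 4)); [lra | apply: lerXn2r; rewrite ?nnegrE; lra].
  have -> : 3 * n ^+ 3 / n ^+ 8 = n^-1 * (3 / n ^+ 4) by field; rewrite gt_eqF.
  rewrite ler_piMr ?invr_ge0 ?(ltW n0) // ler_pdivrMr ?exprn_gt0 //; lra.
have lambda_bound : 0 < lambda <= eps / 64 by apply/andP.
have t_growth : (#|T| ^ 3)%N%:R < (1 + eps / 256) ^+ t by rewrite natrX.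
(* As [H] is fixed before the partition, concentration of its degrees is the only random event; on
   it the guarantees hold for every adversarial choice of outputs. *)
apply: (@le_Pr_partition R T E k k_gt0 _ _ _) => f conc C F M outCF minM; split.
  have [covM _] := minM.
  exact (coreset_vertex_cover sE eps01 lambda_bound beta0 outCF covM).
move=> S [covS _].
exact (coreset_card sE k_gt0 eps01 lambda_bound beta0 edcsH conc t1 t_growth
  outCF minM covS).
Qed.
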